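(* For all integers $n\geq 0$, \begin{align*} a_{37}(43n+12)&\equiv 0 \pmod{43}, & a_{41}(47n+21)&\equiv 0 \pmod{47}, \\ a_{53}(59n+56)&\equiv 0 \pmod{59}, & a_{61}(67n+19)&\equiv 0 \pmod{67},\\ a_{65}(71n+32)&\equiv 0 \pmod{71}, & a_{73}(79n+62)&\equiv 0 \pmod{79},\\ a_{77}(83n+79)&\equiv 0 \pmod{83}. & & \end{align*}
   Context: For an integer $k\geq 1$ let $f_k:=\prod_{n\geq 1}(1-q^{kn})$. For an integer $c\geq 1$, the generalized cubic partition function $a_c(n)$ is defined by the generating function $\sum_{n\geq 0}a_c(n)q^n=\dfrac{1}{f_1f_2^{c-1}}$ (so $a_c(0)=1$). *)

(* Defs.v *)
From mathcomp Require Import all_boot all_order all_algebra.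
Set Implicit Arguments. Unset Strict Implicit. Unset Printing Implicit Defensive.
Import GRing.Theory.
Local Open Scope ring_scope.

(* Truncation of f_1 * f_2^(c-1) = prod_{k>=1} (1-q^k)(1-q^(2k))^(c-1)
   to the factors with k <= N; it agrees with the infinite product
   in all coefficients of degree <= N. *)
Definition f1f2pow (c N : nat) : {poly int} :=
  \prod_(1 <= k < N.+1) ((1 - 'X^k) * (1 - 'X^(2 * k)) ^+ (c - 1)).

(* Coefficients b_0, ..., b_n of the formal power series inverse of a
   power series p with constant term 1:
   b_0 = 1, b_m = - sum_{i=1}^m p_i b_{m-i}. *)
Fixpoint inv_coefs (p : {poly int}) (n : nat) : seq int :=
  match n with
  | 0 => [:: 1]
  | m.+1 =>
      let s := inv_coefs p m in
      rcons s (- \sum_(1 <= i < m.+2) p`_i * nth 0 s (m.+1 - i)%N)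
  end.

Definition a (c n : nat) : int := nth 0 (inv_coefs (f1f2pow c n) n) n.

(* Main.v *)
Require Import Defs.
From mathcomp Require Import all_boot all_order all_algebra.
From mathcomp Require Import finfield ring zify.
From Stdlib Require Import Setoid Morphisms Lia.
Set Implicit Arguments. Unset Strict Implicit. Unset Printing Implicit Defensive.
Import GRing.Theory Num.Theory.
Local Open Scope ring_scope.

(* Write f_k for the Euler product, F = f_1(q), G = f_1(-q), D = q d/dq and [A, B] = A DB - B DA;
   let c = p - 6 with p a prime congruent to 3 mod 4.  Modulo p, f_2^p is a series in q^(2p), so
   1/(f_1 f_2^(p-7)) = (f_2^7/f_1) / f_2^p reduces the claim to the vanishing mod p of the
   coefficients of f_2^7/f_1 at the n with p | 24n + 13.

   These are governed by f_2 [G, F] = -2q f_4^7, that is [G, F] = -2q (f_2^7/f_1)(q^2).  Indeed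
   F^2 = f_2 phi(-q) (Gauss) and G^2 = f_2 phi(q), hence 2 F G [G, F] = f_2^2 [phi(q), phi(-q)],
   where F G f_4 = f_2^3, and [phi(q), phi(-q)] = -4q f_4^6 follows from rotating the double theta
   series by (a, b) -> (a + b + 1, a - b) and applying Jacobi's formula for f_4^3.

   By the pentagonal theorem, F and G are supported on exponents i with 24i + 1 = x^2.  In the
   coefficient of [G, F] at 2n + 1 the terms have x^2 + y^2 = 2 (24n + 13), which p divides, so p
   divides x and y, and hence the factor y^2 - x^2 contributed by the bracket.

   Power series are represented by polynomials, compared up to degree N. *)

(** * Gaussian binomials and the finite Jacobi triple product *)

Fixpoint qbin (R : comNzRingType) (q : R) (n i : nat) : R :=
  match n, i with
  | _, 0 => 1
  | 0, _.+1 => 0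
  | n'.+1, i'.+1 => qbin q n' i' + q ^+ i * qbin q n' i
  end.

Lemma qbin0 (R : comNzRingType) (q : R) n : qbin q n 0 = 1.
Proof. by case: n. Qed.

Lemma qbinS (R : comNzRingType) (q : R) n i :
  qbin q n.+1 i.+1 = qbin q n i + q ^+ i.+1 * qbin q n i.+1.
Proof. by []. Qed.

Lemma qbin_small (R : comNzRingType) (q : R) n i : (n < i)%N -> qbin q n i = 0.
Proof.
elim: n i => [|n IHn] [|i] //= lt_ni.
by rewrite !IHn ?mulr0 ?addr0 // ltnW.
Qed.

(** The mirror image of the defining Pascal rule. In the triple product the defining rule handles a
    new factor in [b], this one a new factor in [a]. *)
Lemma qbinS' (R : comNzRingType) (q : R) n i : (i <= n)%N ->
  qbin q n.+1 i.+1 = q ^+ (n - i) * qbin q n i + qbin q n i.+1.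
Proof.
elim: n i => [|n IHn] i le_in.
  by case: i le_in => //= _; rewrite subnn mulr0 mul1r.
rewrite [LHS]qbinS; have [lt_in|] := ltnP n i; last move=> le_in'.
  have -> : i = n.+1 by lia.
  by rewrite subnn (@qbin_small _ q n.+1 n.+2) // expr0; ring.
rewrite {1}(IHn i) //; case: i le_in le_in' => [|i] le_in le_in'.
  by rewrite !qbin0 !subn0 (qbinS q n 0) qbin0 !exprS expr0; ring.
rewrite {1}(IHn i) 1?ltnW // (qbinS q n i) (qbinS q n i.+1) !subSS.
have -> : (n - i)%N = (n - i.+1).+1 by lia.
by rewrite !exprS; ring.
Qed.

Lemma qbin_rmorph (R S : comNzRingType) (f : {rmorphism R -> S}) (q : R) n i :
  f (qbin q n i) = qbin (f q) n i.
Proof.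
elim: n i => [|n IHn] [|i] /=; rewrite ?rmorph1 ?rmorph0 //.
by rewrite rmorphD rmorphM rmorphXn !IHn.
Qed.

(** The quotient formula cleared of denominators, so that it holds in every commutative ring; the
    induction splits 1 - q^(m+n+2) as (1 - q^(m+1)) + q^(m+1) (1 - q^(n+1)). *)
Lemma qbin_poch (R : comNzRingType) (q : R) m n :
  qbin q (m + n) m * (\prod_(k < m) (1 - q ^+ k.+1) * \prod_(k < n) (1 - q ^+ k.+1))
  = \prod_(k < m + n) (1 - q ^+ k.+1).
Proof.
elim: m n => [|m IHm] n; first by rewrite qbin0 big_ord0 !mul1r.
elim: n => [|n IHn].
  rewrite addn0 big_ord0 mulr1; suff -> : qbin q m.+1 m.+1 = 1 by rewrite mul1r.
  elim: m {IHm} => [|m IHm]; first by rewrite /= mulr0 addr0.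
  by rewrite qbinS IHm qbin_small // mulr0 addr0.
rewrite addSn qbinS [in RHS]big_ord_recr /=.
have H1 := IHm n.+1; have H2 := IHn; rewrite addSn -addnS in H2.
rewrite (big_ord_recr m) (big_ord_recr n) /=.
rewrite (big_ord_recr n) /= in H1; rewrite (big_ord_recr m) /= in H2.
set A := qbin _ _ m in H1 *; set B := qbin _ _ m.+1 in H2 *.
have -> : (1 - q ^+ (m + n.+1).+1) = (1 - q ^+ m.+1) + q ^+ m.+1 * (1 - q ^+ n.+1).
  by rewrite -addSn exprD; ring.
by rewrite [RHS]mulrDr -{1}H1 -H2; ring.
Qed.

(* The index i stands for the power i - n of the usual Laurent variable; the truncated
   differences i - n and n - i are the positive and negative parts of this integer. *)
Definition jterm (R : comNzRingType) (a b d q : R) (n i : nat) : R :=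
  (- a) ^+ (i - n) * (- b) ^+ (n - i) * d ^+ (n - (n - i)) *
  q ^+ ('C(i - n, 2) + 'C(n - i, 2)).

(** The shape shared by both inductions in the triple product: a new factor yields two sums, one of
    them shifted by one index, to be merged by a Pascal rule. *)
Lemma sum_pascal (R : comNzRingType) (u v w : nat -> R) N :
    w 0 = u 0 -> u N = 0 -> (forall i, (i < N)%N -> w i.+1 = u i.+1 + v i) ->
  \sum_(i < N.+1) w i = \sum_(i < N) u i + \sum_(i < N) v i.
Proof.
move=> w0 uN wS; rewrite big_ord_recl w0.
under eq_bigr => i _ do rewrite lift0 wS //.
by rewrite big_split addrA -(big_ord_recl _ (fun i : 'I_N.+1 => u i)) big_ord_recr /= uN addr0.
Qed.

(* A common homogenization of the forms of the triple product in (x, 1/x) and in (a, b) with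
   q = a b; keeping d avoids inverting any element. *)
Lemma finite_triple_product (R : comNzRingType) (a b d q : R) m n : a * b = q * d ->
  \prod_(k < m) (1 - a * q ^+ k) * \prod_(k < n) (d - b * q ^+ k)
  = \sum_(i < (m + n).+1) jterm a b d q n i * qbin q (m + n) i.
Proof.
move=> abqd; elim: m => [|m IHm].
  rewrite big_ord0 mul1r add0n; elim: n => [|n IHn].
    by rewrite big_ord0 big_ord1 qbin0 /jterm !expr0 !mul1r.
  rewrite big_ord_recr IHn /=.
  rewrite (@sum_pascal _ (fun i => - b * q ^+ n * (jterm a b d q n i * qbin q n i))
             (fun i => d * (jterm a b d q n i * qbin q n i))
             (fun i => jterm a b d q n.+1 i * qbin q n.+1 i)).
  - by rewrite -!mulr_sumr; ring.
  - rewrite !qbin0 /jterm !sub0n !subn0 !subnn binS bin1 !exprD !exprS !expr0 /=.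
    by ring.
  - by rewrite qbin_small // mulr0 mulr0.
  move=> i lt_in; rewrite qbinS /jterm !subSS; have -> : (i - n = 0)%N by lia.
  have -> : (n.+1 - (n - i) = (n - (n - i)).+1)%N by lia.
  rewrite exprS mulrDr addrC; congr (_ + _); last by ring.
  have [->|lt_in'] := eqVneq i n; first by rewrite qbin_small // !mulr0.
  have -> : (i.+1 - n = 0)%N by lia.
  have [k Ek] : exists k, (n - i = k.+1)%N by exists (n - i).-1; lia.
  have -> : (n - i.+1 = k)%N by lia.
  have -> : (n - k = i.+1)%N by lia.
  have -> : (n - (n - i) = i)%N by lia.
  rewrite Ek binS bin1; have -> : n = (i.+1 + k)%N by lia.
  by rewrite !add0n !exprD (exprS _ k) (exprS d i); ring.
rewrite big_ord_recr /= mulrAC IHm addSn.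
rewrite (@sum_pascal _ (fun i => jterm a b d q n i * qbin q (m + n) i)
           (fun i => - a * q ^+ m * (jterm a b d q n i * qbin q (m + n) i))
           (fun i => jterm a b d q n i * qbin q (m + n).+1 i)).
- by rewrite -mulr_sumr; ring.
- by rewrite !qbin0.
- by rewrite qbin_small // mulr0.
move=> i le_iM; rewrite qbinS' // mulrDr addrC; congr (_ + _).
rewrite !mulrA; congr (_ * _); rewrite /jterm.
have [le_ni|lt_in] := leqP n i.
  have [j Ej] : exists j, i = (n + j)%N by exists (i - n)%N; lia.
  subst i.
  rewrite -addnS !addKn; have -> : (n - (n + j) = 0)%N by lia.
  have -> : (n - (n + j.+1) = 0)%N by lia.
  rewrite subn0 binS bin1 !addn0 exprD.
  have -> : (m + n - (n + j) = m - j)%N by lia.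
  rewrite -{2}(subnK (_ : j <= m)%N) ?exprD ?exprS; last by lia.
  by ring.
have [l El] : exists l, (n - i = l.+1)%N by exists (n - i).-1; lia.
have -> : (n - i.+1 = l)%N by lia.
have -> : (i.+1 - n = 0)%N by lia.
have -> : (i - n = 0)%N by lia.
have -> : (n - l = i.+1)%N by lia.
have -> : (n - (n - i) = i)%N by lia.
rewrite El; have -> : (m + n - i = m + l.+1)%N by lia.
by rewrite binS bin1 !expr0 !exprD !exprS; ring: abqd.
Qed.

(** * Equality of polynomials up to degree N *)

Definition eqm (R : nzRingType) (N : nat) (p q : {poly R}) : Prop :=
  forall i, (i <= N)%N -> p`_i = q`_i.

Lemma eqm_refl (R : nzRingType) N (p : {poly R}) : eqm N p p.
Proof. by []. Qed.

Lemma eqm_sym (R : nzRingType) N (p q : {poly R}) : eqm N p q -> eqm N q p.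
Proof. by move=> pq i /pq. Qed.

Lemma eqm_trans (R : nzRingType) N (p q r : {poly R}) : eqm N p q -> eqm N q r -> eqm N p r.
Proof. by move=> pq qr i le_iN; rewrite pq ?qr. Qed.

Add Parametric Relation (R : nzRingType) (N : nat) : {poly R} (@eqm R N)
  reflexivity proved by (@eqm_refl R N)
  symmetry proved by (@eqm_sym R N)
  transitivity proved by (@eqm_trans R N) as eqm_rel.

Lemma eqmD (R : nzRingType) N (p p' q q' : {poly R}) :
  eqm N p p' -> eqm N q q' -> eqm N (p + q) (p' + q').
Proof. by move=> pp' qq' i le_iN; rewrite !coefD pp' ?qq'. Qed.

Lemma eqmN (R : nzRingType) N (p p' : {poly R}) : eqm N p p' -> eqm N (- p) (- p').
Proof. by move=> pp' i le_iN; rewrite !coefN pp'. Qed.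

Lemma eqmM (R : nzRingType) N (p p' q q' : {poly R}) :
  eqm N p p' -> eqm N q q' -> eqm N (p * q) (p' * q').
Proof.
move=> pp' qq' i le_iN; rewrite !coefM; apply: eq_bigr => j _.
by rewrite pp' ?qq' ?(leq_trans (leq_subr _ _)) // (leq_trans _ le_iN) // -ltnS.
Qed.

Lemma eqmX (R : nzRingType) N (p p' : {poly R}) n : eqm N p p' -> eqm N (p ^+ n) (p' ^+ n).
Proof. by move=> pp'; elim: n => [|n IHn] //; rewrite !exprS; apply: eqmM. Qed.

Lemma eqm_sum (R : nzRingType) N (I : Type) (s : seq I) (P : pred I) (f g : I -> {poly R}) :
  (forall i, P i -> eqm N (f i) (g i)) ->
  eqm N (\sum_(i <- s | P i) f i) (\sum_(i <- s | P i) g i).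
Proof. by move=> fg; elim/big_ind2: _ => // *; apply: eqmD. Qed.

Add Parametric Morphism (R : nzRingType) (N : nat) : (@GRing.mul {poly R})
  with signature @eqm R N ==> @eqm R N ==> @eqm R N as eqm_mul_mor.
Proof. by move=> *; apply: eqmM. Qed.

(** Replaces division of power series: the coefficients of p - q vanish one after the other, from
    the lowest up. *)
Lemma eqm_mulI (R : idomainType) N (u p q : {poly R}) :
  u`_0 != 0 -> eqm N (u * p) (u * q) -> eqm N p q.
Proof.
move=> u0 upq; suff r0 i : (i <= N)%N -> (p - q)`_i = 0.
  by move=> i /r0 /eqP; rewrite coefB subr_eq0 => /eqP.
elim/ltn_ind: i => i IHi le_iN; have /eqP := upq i le_iN.
rewrite -subr_eq0 -coefB -mulrBr coefM big_ord_recl subn0 big1 ?addr0 => [|j _].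
  by rewrite mulf_eq0 (negPf u0) => /eqP.
rewrite IHi ?mulr0 //= /bump /=; first by have := ltn_ord j; lia.
by rewrite (leq_trans (leq_subr _ _)).
Qed.

Lemma eqm_Xn (R : nzRingType) N n (p : {poly R}) : (N < n)%N -> eqm N (p * 'X^n) 0.
Proof. by move=> lt_Nn i le_iN; rewrite coefMXn coef0 (leq_ltn_trans le_iN). Qed.

(** * Truncated Euler products and the limit of the triple product *)

Definition euler (L k : nat) : {poly int} := \prod_(j < L) (1 - 'X^(k * j.+1)).

Lemma euler_coef0 L k : (0 < k)%N -> (euler L k)`_0 = 1.
Proof.
move=> k0; rewrite -horner_coef0 /euler horner_prod big1 // => j _.
by rewrite !hornerE expr0n muln_eq0 /= -leqn0 leqNgt k0 subr0.
Qed.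

Lemma euler_stable N L L' k : (L <= L')%N -> (N < k * L.+1)%N ->
  eqm N (euler L k) (euler L' k).
Proof.
move=> /subnK <- ltN; elim: (L' - L)%N => [|d IHd] //.
rewrite addSn /euler big_ord_recr /= mulrBr mulr1 -[X in eqm N X _]subr0.
apply: eqmD => //; apply/eqmN/eqm_sym/eqm_Xn/(leq_trans ltN).
by rewrite leq_mul2l ltnS leq_addl orbT.
Qed.

Lemma prod_euler e n : \prod_(k < n) (1 - ('X^e : {poly int}) ^+ k.+1) = euler n e.
Proof. by apply: eq_bigr => k _; rewrite -exprM. Qed.

(* Each Gaussian binomial tends to the inverse of the Euler product away from the ends. *)
Lemma qbin_limit N e n (u : nat -> {poly int}) : (0 < e)%N ->
    (forall i, (i <= n)%N -> (N <= i <= n - N)%N \/ eqm N (u i) 0) ->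
  eqm N (euler N e * \sum_(i < n.+1) u i * qbin 'X^e n i) (\sum_(i < n.+1) u i).
Proof.
move=> e0 u_small; rewrite mulr_sumr; apply: eqm_sum => i _.
have [/andP[le_Ni le_in]|ui0] := u_small i (leq_ord i); last first.
  by rewrite ui0 mul0r mulr0.
have st L : (N <= L)%N -> eqm N (euler N e) (euler L e).
  by move=> le_NL; apply: euler_stable; last by rewrite (leq_trans _ (leq_pmull _ e0)).
have le_i := leq_ord i.
(* In [qbin_poch] the Euler products of lengths i, n - i and n all agree with [euler N e] up to
   degree N, because all three lengths are at least N; one copy then cancels. *)
suff h : eqm N (euler N e * qbin 'X^e n i) 1 by rewrite mulrCA h mulr1.
have := qbin_poch ('X^e : {poly int}) i (n - i); rewrite subnKC // !prod_euler => H.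
apply: (@eqm_mulI _ N (euler N e)); first by rewrite euler_coef0.
rewrite mulr1 {3}(st n); last by lia.
rewrite -H {1}(st i) // (st (n - i)%N); last by lia.
by rewrite mulrA mulrC.
Qed.

Definition zrange (K : nat) : seq int := [seq i%:Z - K%:Z | i <- iota 0 (K + K).+1].

Lemma mem_zrange K z : (z \in zrange K) = (`|z| <= K)%N.
Proof.
apply/mapP/idP => [[i]|le_zK]; first by rewrite mem_iota => ? ->; lia.
by exists `|(z + K%:Z)%R|%N; [rewrite mem_iota; lia | lia].
Qed.

Lemma uniq_zrange K : uniq (zrange K).
Proof. by rewrite map_inj_uniq ?iota_uniq // => i j; lia. Qed.

Lemma sum_zrange N K m n (g : int -> {poly int}) : (K <= m)%N -> (K <= n)%N ->
    (forall z, (K < `|z|)%N -> eqm N (g z) 0) ->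
  eqm N (\sum_(i < (m + n).+1) g (i%:Z - n%:Z)) (\sum_(z <- zrange K) g z).
Proof.
move=> le_Km le_Kn g0.
rewrite -(big_mkord xpredT (fun i : nat => g (i%:Z - n%:Z))) /index_iota subn0.
rewrite -(big_map (fun i : nat => i%:Z - n%:Z) xpredT g).
set s := map _ _; have s_uniq : uniq s by rewrite map_inj_uniq ?iota_uniq // => i j; lia.
rewrite (bigID (fun z : int => `|z| <= K)%N) /= -[X in eqm N _ X]addr0.
apply: eqmD; last first.
  apply: (eqm_trans (eqm_sum (g := fun=> 0) _ _)) => [z|]; last by rewrite big1_eq.
  by rewrite -ltnNge => /g0.
rewrite -big_filter (perm_big (zrange K)) //; apply: uniq_perm.
- exact: filter_uniq.
- exact: uniq_zrange.
move=> z; rewrite mem_filter mem_zrange andb_idr // => le_zK.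
by apply/mapP; exists `|(z + n%:Z)%R|%N; [rewrite mem_iota; lia | lia].
Qed.

(** With z = i - n, the terms with |z| > K are negligible, and the indices with |z| <= K lie at
    distance at least N from both ends, where [qbin_limit] applies. *)
Lemma theta_limit N K e m n (g : int -> {poly int}) :
    (0 < e)%N -> (K + N <= m)%N -> (K + N <= n)%N ->
    (forall z, (K < `|z|)%N -> eqm N (g z) 0) ->
  eqm N (euler N e * \sum_(i < (m + n).+1) g (i%:Z - n%:Z) * qbin 'X^e (m + n) i)
        (\sum_(z <- zrange K) g z).
Proof.
move=> e0 le_m le_n g0.
have H := @qbin_limit N e (m + n) (fun i => g (i%:Z - n%:Z)) e0.
apply: eqm_trans (H _) _ => [i le_i|]; last by apply: sum_zrange => //; lia.
have [le_z|lt_z] := leqP `|(i%:Z - n%:Z)%R|%N K; [left; lia | right; exact: g0].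
Qed.

(** * Gauss's theta identity, pentagonal exponents and Jacobi's formula for the cube *)

Lemma double_bin2 n : (2 * 'C(n, 2) + n = n * n)%N.
Proof. by elim: n => // n IHn; rewrite binS bin1; lia. Qed.

Lemma jterm_Xn al be n i :
  jterm ('X^al) ('X^be) 1 ('X^(al + be)) n i
  = (-1) ^+ `|(i%:Z - n%:Z)%R|%N * 'X^(al * (i - n) + be * (n - i)
      + (al + be) * ('C(i - n, 2) + 'C(n - i, 2))) :> {poly int}.
Proof.
have -> : `|(i%:Z - n%:Z)%R|%N = (i - n + (n - i))%N by lia.
rewrite /jterm expr1n mulr1 !(exprNn 'X^_) -!exprM !exprD.
by ring.
Qed.

Lemma prod_split2 (R : comNzRingType) (f : nat -> R) K :
  \prod_(j < 2 * K) f j = \prod_(k < K) (f (2 * k)%N * f (2 * k).+1).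
Proof.
elim: K => [|K IHK]; first by rewrite !big_ord0.
by rewrite mulnS !big_ord_recr /= IHK mulrA.
Qed.

Lemma prod_split3 (R : comNzRingType) (f : nat -> R) K :
  \prod_(j < 3 * K) f j = \prod_(k < K) (f (3 * k)%N * f (3 * k).+1 * f (3 * k).+2).
Proof.
elim: K => [|K IHK]; first by rewrite !big_ord0.
by rewrite mulnS !big_ord_recr /= IHK !mulrA.
Qed.

Lemma eqm_of_eq (R : nzRingType) N (p q : {poly R}) : p = q -> eqm N p q.
Proof. by move->. Qed.

(** Truncation of phi(-q). *)
Definition theta_alt (K : nat) : {poly int} :=
  \sum_(z <- zrange K) (-1) ^+ `|z| * 'X^(`|z| ^ 2).

(** The triple product with a = b = q and base q^2 gives phi(-q) = f_2 times the square of the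
    product of the 1 - q^(2k+1); with another f_2, odd and even factors combine into f_1^2. *)
Lemma gauss_theta N : eqm N (euler N 2 * theta_alt N) (euler N 1 ^+ 2).
Proof.
set n := (N + N)%N.
have H := @theta_limit N N 2 n n (fun z => (-1) ^+ `|z| * 'X^(`|z| ^ 2)) isT
  (leqnn _) (leqnn _).
rewrite /theta_alt -H => [|z lt_Nz]; last first.
  by apply: eqm_Xn; rewrite (leq_trans lt_Nz) // -mulnn; nia.
have E i : (-1) ^+ `|(i%:Z - n%:Z)%R| * 'X^(`|(i%:Z - n%:Z)%R| ^ 2)
           = jterm 'X 'X 1 'X^2 n i :> {poly int}.
  rewrite (jterm_Xn 1 1); congr (_ * 'X^_); rewrite -mulnn.
  have := double_bin2 (i - n); have := double_bin2 (n - i).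
  by have [le_in|lt_ni] := leqP i n; nia.
under eq_bigr do rewrite E.
rewrite -finite_triple_product; last by rewrite mulr1.
have st2 : eqm N (euler N 2) (euler n 2) by apply: euler_stable; lia.
have st1 : eqm N (euler N 1) (euler (2 * n) 1) by apply: euler_stable; lia.
apply: eqm_trans (eqmM st2 (eqmM st2 (@eqm_refl _ _ _))) _.
apply: (eqm_trans _ (eqm_sym (eqmX 2 st1))).
have -> : euler (2 * n) 1 = \prod_(k < n) (1 - 'X * 'X^2 ^+ k) * euler n 2.
  rewrite /euler (prod_split2 (fun j => 1 - 'X^(1 * j.+1))) big_split.
  congr (_ * _); apply: eq_bigr => k _.
    by rewrite -exprM -exprS mul1n.
  by rewrite mul1n mulnS.
by apply: eqm_of_eq; ring.
Qed.

(** The triple product with a = q, b = q^2 and base q^3 expands f_1, its three kinds of factors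
    being those of f_1 sorted by exponent mod 3. Only the exponents matter later, not the signs. *)
Lemma pentagonal_support L i : (i <= L)%N -> (euler L 1)`_i != 0 ->
  exists x : int, 24 * i%:Z + 1 = x ^+ 2.
Proof.
move=> le_iL; set n := (L + L)%N.
pose u (i : nat) : {poly int} := jterm 'X 'X^2 1 'X^3 n i.
have uE j : u j = (-1) ^+ `|(j%:Z - n%:Z)%R|%N * 'X^(1 * (j - n) + 2 * (n - j)
      + 3 * ('C(j - n, 2) + 'C(n - j, 2))) by rewrite -(jterm_Xn 1 2).
have u_small j : (j <= n + n)%N -> (L <= j <= n + n - L)%N \/ eqm L (u j) 0.
  move=> le_j; have [le_z|lt_z] := leqP `|(j%:Z - n%:Z)%R|%N L; [left; lia | right].
  by rewrite uE; apply: eqm_Xn; lia.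
have H := @qbin_limit L 3 (n + n) u isT u_small.
have Hp : eqm L (euler L 1) (\sum_(j < (n + n).+1) u j).
  apply: eqm_trans _ H; rewrite /u -finite_triple_product; last by rewrite mulr1 -exprS.
  have st3 : eqm L (euler L 3) (euler n 3) by apply: euler_stable; lia.
  have st1 : eqm L (euler L 1) (euler (3 * n) 1) by apply: euler_stable; lia.
  apply: eqm_trans st1 (eqm_trans _ (eqm_sym (eqmM st3 (@eqm_refl _ _ _)))).
  apply: eqm_of_eq; rewrite /euler (prod_split3 (fun j => 1 - 'X^(1 * j.+1))).
  rewrite !big_split [RHS]mulrC; congr (_ * _ * _); apply: eq_bigr => k _.
  - by rewrite mul1n -exprM -exprS.
  - by rewrite mul1n -exprM -exprD.
  - by rewrite mul1n mulnS.
rewrite (Hp i le_iL) coef_sum => sum_neq0.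
have [j /eqP] : exists j : 'I_(n + n).+1, (u j)`_i != 0.
  apply/existsP; apply: contraR sum_neq0; rewrite negb_exists => /forallP u0.
  by rewrite big1 // => j _; apply/eqP; rewrite -[_ == _]negbK.
rewrite uE -signr_odd mulr_sign.
have -> p : (if odd `|(j%:Z - n%:Z)%R| then - p else p : {poly int})`_i
  = (if odd `|(j%:Z - n%:Z)%R| then -1 else 1) * p`_i by case: ifP; rewrite ?coefN ?mulN1r ?mul1r.
rewrite coefXn; have [-> _|] := eqVneq; last by rewrite mulr0.
have := double_bin2 (j - n); have := double_bin2 (n - j).
(* With z = j - n the exponent is z(3z - 1)/2, and 24 times it plus 1 is (6z - 1)^2. *)
by exists (6 * (j%:Z - n%:Z) - 1); have [le_jn|lt_nj] := leqP j n; nia.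
Qed.

(* The derivative at x = 1 of the finite triple product in x. *)
Lemma finite_jacobi (R : comNzRingType) (q : R) n :
  2 * (\prod_(k < n) (1 - q ^+ k.+1)) ^+ 2
  = \sum_(i < (n + n.+1).+1) (2 * i%:Z - 2 * n%:Z - 1)%:~R *
      jterm q 1 1 q n.+1 i * qbin q (n + n.+1) i.
Proof.
set P := \prod_(k < n) _.
have [c cE] : {c | forall i, c i = jterm q 1 1 q n.+1 i * qbin q (n + n.+1) i}.
  by eexists.
(* The variable x is ['X], with a = xq, b = 1, d = x. [W] is the product without its factor x - 1,
   so W(1) is the derivative of the full product at x = 1. *)
pose W : {poly R} := \prod_(k < n) (1 - 'X * q%:P * q%:P ^+ k) * \prod_(k < n) ('X - q%:P ^+ k.+1).
have J : ('X - 1) * W = \sum_(i < (n + n.+1).+1) (c i)%:P * 'X^i.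
  transitivity (\prod_(k < n) (1 - 'X * q%:P * q%:P ^+ k) *
                \prod_(k < n.+1) ('X - 1 * q%:P ^+ k)).
    rewrite big_ord_recl /= mul1r mulrCA; congr (_ * (_ * _)).
    by apply: eq_bigr => k _; rewrite mul1r.
  rewrite finite_triple_product; last by rewrite mulr1 mulrC.
  apply: eq_bigr => i _; rewrite -(qbin_rmorph polyC) cE rmorphM /=.
  have EX : 'X^i = 'X^(i - n.+1) * 'X^(n.+1 - (n.+1 - i)) :> {poly R}.
    by rewrite -exprD; congr (_ ^+ _); lia.
  rewrite /jterm expr1n mulr1 !(rmorphM, rmorphXn, rmorphN, rmorph1) /= EX.
  by rewrite -mulrN exprMn; ring.
have W1 : W.[1] = P ^+ 2.
  rewrite /W hornerM !horner_prod expr2; congr (_ * _); apply: eq_bigr => k _.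
    by rewrite -mulrA -exprS -rmorphXn !hornerE.
  by rewrite -rmorphXn !hornerE.
clearbody W; have c0 : \sum_(i < (n + n.+1).+1) c i = 0.
  transitivity (('X - 1) * W).[1]; last by rewrite !hornerE subrr mul0r.
  by rewrite J horner_sum; apply: eq_bigr => i _; rewrite !hornerE expr1n mulr1.
have c1 : \sum_(i < (n + n.+1).+1) i%:R * c i = P ^+ 2.
  transitivity (('X - 1) * W)^`().[1]; last by rewrite derivM !derivE !hornerE W1; ring.
  rewrite J raddf_sum horner_sum; apply: eq_bigr => i _.
  by rewrite /= derivM !derivE !hornerE ?hornerMn ?hornerE ?expr1n; ring.
(* As the [c i] sum to 0, the weight 2i may be shifted by 2n + 1; it becomes 2z + 1 for z = i - (n +
   1). *)
transitivity (2 * (\sum_(i < (n + n.+1).+1) i%:R * c i)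
              - (2 * n%:R + 1) * \sum_(i < (n + n.+1).+1) c i).
  by rewrite c0 c1 mulr0 subr0.
rewrite !mulr_sumr -sumrB.
apply: eq_bigr => i _; rewrite -mulrA -cE !rmorphB !rmorphM /=; ring.
Qed.

(** Truncation of the two-sided Jacobi series in q^4. In the full series z and -1 - z contribute
    equally, so its sum is 2 f_4^3. *)
Definition theta_jacobi (K : nat) : {poly int} :=
  \sum_(z <- zrange K) (2 * z + 1)%:~R * (-1) ^+ `|z| * 'X^(2 * `|(z * (z + 1))%R|).

Lemma jacobi_cube N : eqm N (theta_jacobi N.+1) (2 * euler N 4 ^+ 3).
Proof.
set n := (N + N).+1.
pose g (z : int) : {poly int} := (2 * z + 1)%:~R * (-1) ^+ `|z| * 'X^(2 * `|(z * (z + 1))%R|).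
have g_small z : (N.+1 < `|z|)%N -> eqm N (g z) 0 by move=> lt_Nz; apply: eqm_Xn; nia.
have H : eqm N _ (theta_jacobi N.+1) :=
  @theta_limit N N.+1 4 n n.+1 g isT (leqnn _) (leqnSn _) g_small.
apply: eqm_trans (eqm_sym H) _.
have st : eqm N (euler N 4) (euler n 4) by apply: euler_stable; lia.
apply: eqm_trans (_ : eqm N _ (2 * (euler N 4 * euler n 4 ^+ 2))) _; last first.
  apply: eqm_trans (eqmM (eqm_refl _) (eqmM (eqm_refl _) (eqmX 2 (eqm_sym st)))) _.
  by apply: eqm_of_eq; rewrite -exprS.
apply: eqm_of_eq; rewrite mulrCA; congr (_ * _).
rewrite -prod_euler finite_jacobi; apply: eq_bigr => i _; congr (_ * _).
rewrite /g (jterm_Xn 4 0) mulrA; congr (_%:~R * _ * 'X^_); first by lia.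
have := double_bin2 (i - n.+1); have := double_bin2 (n.+1 - i).
by have [le_in|lt_ni] := leqP i n.+1; nia.
Qed.

(** * The bracket of phi(q) and phi(-q) by rotation of the double sum *)

Definition bracket (p q : {poly int}) : {poly int} := 'X * (p * q^`() - q * p^`()).

Definition theta (K : nat) : {poly int} := \sum_(z <- zrange K) 'X^(`|z| ^ 2).

Lemma absz_sqr z : (`|z| ^ 2)%N%:Z = z * z.
Proof. by rewrite -mulnn; lia. Qed.

Lemma rot_exponent a b :
  (`|(a + b + 1)%R| ^ 2 + `|(a - b)%R| ^ 2 =
   2 * `|(a * (a + 1))%R| + 2 * `|(b * (b + 1))%R| + 1)%N.
Proof.
apply/eqP; rewrite -eqz_nat !PoszD !absz_sqr.
have pronic z : `|(z * (z + 1))%R|%N%:Z = z * (z + 1) by nia.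
by rewrite !pronic; apply/eqP; ring.
Qed.

Lemma poly_int_eqN (p : {poly int}) : p = - p -> p = 0.
Proof.
move=> pN; apply/polyP => i; have: p`_i = - p`_i by rewrite {1}pN coefN.
by rewrite coef0; lia.
Qed.

Lemma odd_absz_half z : odd `|z| -> exists y : int, z = 2 * y + 1.
Proof.
move=> z_odd; have := odd_double_half `|z|; rewrite z_odd => E.
by case: (lerP 0 z) => ?; [exists `|z|./2%:Z | exists (- `|z|./2%:Z - 1)]; lia.
Qed.

Lemma sum_rot N (h : int -> int -> {poly int}) :
  (forall s t, (N < `|s| ^ 2 + `|t| ^ 2)%N -> eqm N (h s t) 0) ->
  (forall s t, ~~ odd `|(s + t)%R| -> h t s = - h s t) ->
  eqm N (\sum_(s <- zrange N) \sum_(t <- zrange N) h s t)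
        (\sum_(a <- zrange N.+1) \sum_(b <- zrange N.+1) h (a + b + 1) (a - b)).
Proof.
move=> h_small h_anti.
set F := fun p : int * int => h p.1 p.2.
pose e (p : int * int) := (`|p.1| ^ 2 + `|p.2| ^ 2)%N.
pose o (p : int * int) := odd `|(p.1 + p.2)%R|.
have small (r : seq (int * int)) (P : pred (int * int)) :
    eqm N (\sum_(p <- r | P p) F p) (\sum_(p <- r | P p && (e p <= N)%N) F p).
  rewrite (bigID (fun p => e p <= N)%N) /= -[X in eqm N _ X]addr0.
  apply/eqmD => //; apply: (eqm_trans (eqm_sum (g := fun=> 0) _ _)) => [p|].
    by rewrite -ltnNge => /andP[_]; apply: h_small.
  by rewrite big1_eq.
have -> : \sum_(s <- zrange N) \sum_(t <- zrange N) h s t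
    = \sum_(p <- [seq (s, t) | s <- zrange N, t <- zrange N] | o p) F p.
  rewrite -(big_allpairs (F := F)) (bigID o) -[RHS]addr0; congr (_ + _); apply: poly_int_eqN.
  rewrite -sumrN big_mkcond [RHS]big_mkcond !big_allpairs exchange_big.
  apply: eq_bigr => s _; apply: eq_bigr => t _; rewrite /o /F /= addrC.
  by case: ifP => // /h_anti ->.
have -> : \sum_(a <- zrange N.+1) \sum_(b <- zrange N.+1) h (a + b + 1) (a - b)
    = \sum_(p <- [seq (a + b + 1, a - b) | a <- zrange N.+1, b <- zrange N.+1]) F p.
  by rewrite big_allpairs_dep.
apply: eqm_trans (small _ _) (eqm_sym (eqm_trans (small _ xpredT) _)).
apply: eqm_of_eq; rewrite -big_filter -[RHS]big_filter; apply: perm_big.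
apply: uniq_perm.
- apply/filter_uniq/allpairs_uniq; rewrite ?uniq_zrange // => -[a b] [c d] _ _ [] /= ? ?.
  by congr (_, _); lia.
- by apply/filter_uniq/allpairs_uniq; rewrite ?uniq_zrange // => -[? ?] [? ?] _ _ [-> ->].
move=> [s t]; rewrite !mem_filter; apply/idP/idP.
  case/andP=> le_e /allpairsP[[a b] [_ _ [Es Et]]].
  have -> : o (s, t) by move: Es Et; rewrite /o /=; lia.
  rewrite le_e !andTb.
  by apply/allpairsP; exists (s, t); rewrite !mem_zrange; split=> //;
    move: le_e; rewrite /e /=; nia.
case/andP=> /andP[odd_st le_e] _; rewrite andTb le_e andTb.
(* Writing s + t = 2a + 1 and b = a - t gives a + b + 1 = s and a - b = t. *)
have [a Ea] := odd_absz_half odd_st; apply/allpairsP; exists (a, a - t).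
move: le_e; rewrite /e /= => le_e.
have le_s : (`|s| <= N)%N by nia.
have le_t : (`|t| <= N)%N by nia.
rewrite /= in Ea; rewrite !mem_zrange /=.
by split; [lia | lia | congr (_, _); lia].
Qed.

(** The pair (s, t) contributes (t^2 - s^2) (-1)^t q^(s^2 + t^2), antisymmetric when s and t have
    equal parity; after rotation the weight factors as -(2a + 1)(2b + 1). *)
Lemma bracket_theta N :
  eqm N (bracket (theta N) (theta_alt N)) (- ('X * theta_jacobi N.+1 ^+ 2)).
Proof.
pose h s t : {poly int} := (t * t - s * s)%:~R * (-1) ^+ `|t| * 'X^(`|s| ^ 2 + `|t| ^ 2).
have XD (K : nat) (c : int -> {poly int}) : (forall z, (c z)^`() = 0) ->
    'X * (\sum_(z <- zrange K) c z * 'X^(`|z| ^ 2))^`()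
    = \sum_(z <- zrange K) (z * z)%:~R * c z * 'X^(`|z| ^ 2).
  move=> c0; rewrite raddf_sum mulr_sumr; apply: eq_bigr => z _.
  rewrite /= derivM c0 mul0r add0r derivXn -absz_sqr -pmulrn.
  case: (`|z| ^ 2)%N => [|k]; first by rewrite !mulr0n; ring.
  by rewrite !mulrnAr -mulrA mulr_natl exprS mulrCA.
have -> : bracket (theta N) (theta_alt N) = \sum_(s <- zrange N) \sum_(t <- zrange N) h s t.
  have -> : bracket (theta N) (theta_alt N)
    = theta N * ('X * (theta_alt N)^`()) - ('X * (theta N)^`()) * theta_alt N.
    by rewrite /bracket; ring.
  have -> : 'X * (theta N)^`() = \sum_(z <- zrange N) (z * z)%:~R * 'X^(`|z| ^ 2).
    have := XD N (fun=> 1) (fun=> derivC _).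
    under eq_bigr do rewrite mul1r.
    by under [in X in _ = X -> _]eq_bigr do rewrite mulr1.
  rewrite XD; last by move=> z; rewrite -signr_odd; case: odd; rewrite ?derivN derivC ?oppr0.
  rewrite /theta /theta_alt !big_distrlr -sumrB; apply: eq_bigr => s _.
  rewrite -sumrB; apply: eq_bigr => t _.
  by rewrite /h exprD rmorphB /=; ring.
apply: eqm_trans (sum_rot _ _) _.
- by move=> s t; apply: eqm_Xn.
- move=> s t st_even; rewrite /h [(`|t| ^ 2 + _)%N]addnC -[in LHS]signr_odd -[in RHS]signr_odd.
  have -> : odd `|s| = odd `|t| by lia.
  by rewrite -opprB rmorphN /=; ring.
apply: eqm_of_eq; rewrite /theta_jacobi expr2 big_distrlr mulr_sumr -sumrN.
apply: eq_bigr => a _; rewrite mulr_sumr -sumrN; apply: eq_bigr => b _.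
rewrite /h rot_exponent !exprD expr1.
have -> : (a - b) * (a - b) - (a + b + 1) * (a + b + 1) = - ((2 * a + 1) * (2 * b + 1)) by ring.
have -> : (-1) ^+ `|a - b| = (-1) ^+ `|a| * (-1) ^+ `|b| :> {poly int}.
  by rewrite -signr_odd -exprD -[RHS]signr_odd; congr (_ ^+ nat_of_bool _); lia.
by rewrite rmorphN rmorphM /=; ring.
Qed.

(** * The substitution of -q for q and the bracket of f_1(-q) and f_1(q) *)

Lemma coef_comp_polyNX (R : comNzRingType) (p : {poly R}) i :
  (p \Po (- 'X))`_i = (-1) ^+ i * p`_i.
Proof.
elim/poly_ind: p i => [|p c IHp] i; first by rewrite comp_poly0 coef0 mulr0.
rewrite comp_poly_MXaddC mulrN !coefD coefN !coefC !coefMX.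
by case: i => [|i] /=; rewrite ?IHp ?exprS; ring.
Qed.

Lemma eqm_compNX (R : comNzRingType) N (p q : {poly R}) :
  eqm N p q -> eqm N (p \Po (- 'X)) (q \Po (- 'X)).
Proof. by move=> pq i le_iN; rewrite !coef_comp_polyNX pq. Qed.

Lemma theta_alt_compNX N : theta_alt N \Po (- 'X) = theta N.
Proof.
rewrite /theta_alt raddf_sum; apply: eq_bigr => z _ /=.
apply/polyP => i; rewrite coef_comp_polyNX -(signr_odd _ `|z|) mulr_sign.
case Eo: (odd `|z|); rewrite ?coefN !coefXn; case: eqP => [->|_]; rewrite ?oppr0 ?mulr0 //.
  by rewrite -signr_odd -mulnn oddM Eo mulrN1 opprK.
by rewrite -signr_odd -mulnn oddM Eo mulr1.
Qed.

Lemma euler_comp N k (q : {poly int}) : euler N k \Po q = \prod_(j < N) (1 - q ^+ (k * j.+1)).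
Proof.
rewrite /euler rmorph_prod; apply: eq_bigr => j _ /=.
by rewrite rmorphB rmorph1 /= comp_Xn_poly.
Qed.

Lemma euler_compNX_even N k : euler N (2 * k) \Po (- 'X) = euler N (2 * k).
Proof. by rewrite euler_comp; apply: eq_bigr => j _; rewrite -mulnA !exprM sqrrN. Qed.

Lemma euler_comp_Xn N k l : euler N k \Po 'X^l = euler N (l * k).
Proof. by rewrite euler_comp; apply: eq_bigr => j _; rewrite -exprM mulnA. Qed.

(** In f_1(q) f_1(-q) the even factors give f_2^2; the odd ones pair to 1 - q^(2(2k+1)), the factors
    of f_2 that are not in f_4. *)
Lemma euler_mul_compNX N :
  eqm N (euler N 1 * (euler N 1 \Po (- 'X)) * euler N 4) (euler N 2 ^+ 3).
Proof.
have st K k : (0 < k)%N -> (N <= K)%N -> eqm N (euler N k) (euler K k).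
  by move=> k0 le_NK; apply: euler_stable => //; nia.
have st1 : eqm N (euler N 1) (euler (2 * N) 1) by apply: st; lia.
have st2 : eqm N (euler (2 * N) 2) (euler N 2) by apply/eqm_sym/st; lia.
apply: eqm_trans (eqmM (eqmM st1 (eqm_compNX st1)) (eqm_refl _)) _.
apply: (eqm_trans _ (eqmM st2 (eqm_refl (euler N 2 ^+ 2)))).
apply: eqm_of_eq; rewrite expr2 euler_comp /euler.
rewrite !(prod_split2 (fun j => 1 - _ ^+ (_ * j.+1))) -!big_split /=.
apply: eq_bigr => k _; rewrite !mul1n.
have -> : (- 'X) ^+ (2 * k).+1 = - 'X^((2 * k).+1) :> {poly int}.
  by rewrite exprNn -signr_odd /= oddM mulN1r.
have -> : (- 'X) ^+ (2 * k).+2 = 'X^((2 * k).+2) :> {poly int}.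
  by rewrite exprNn -signr_odd /= oddM mul1r.
have -> : (4 * k.+1 = 2 * (2 * k).+2)%N by lia.
have -> : (2 * k.+1 = (2 * k).+2)%N by lia.
by rewrite (mulnC 2 (2 * k).+1) (exprM _ _ 2); ring.
Qed.

Lemma bracket_mul p q r : bracket (r * p) (r * q) = r ^+ 2 * bracket p q.
Proof. by rewrite /bracket !derivM; ring. Qed.

Lemma bracket_sqr p q : bracket (p ^+ 2) (q ^+ 2) = 2 * p * q * bracket p q.
Proof. by rewrite /bracket !expr2 !derivM; ring. Qed.

(** The factor ['X] in the bracket restores the degree of precision that differentiation loses. *)
Lemma eqm_bracket N p p' q q' : eqm N p p' -> eqm N q q' ->
  eqm N (bracket p q) (bracket p' q').
Proof.
have XD r r' : eqm N r r' -> eqm N ('X * r^`()) ('X * r'^`()).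
  by move=> rr' [|i] le_iN; rewrite !coefXM //= !coef_deriv rr'.
have E r s : bracket r s = r * ('X * s^`()) - s * ('X * r^`()) by rewrite /bracket; ring.
move=> pp' qq'; rewrite !E.
by apply: eqmD; [apply: eqmM => //; apply: XD | apply/eqmN/eqmM => //; apply: XD].
Qed.

Lemma bracket_euler N :
  eqm N (euler N 2 * bracket (euler N 1 \Po (- 'X)) (euler N 1))
        (- (2 * 'X * euler N 4 ^+ 7)).
Proof.
set F := euler N 1; set G := F \Po _; set E2 := euler N 2; set E4 := euler N 4.
have gF : eqm N (E2 * theta_alt N) (F ^+ 2) := @gauss_theta N.
have gG : eqm N (E2 * theta N) (G ^+ 2).
  have := eqm_compNX gF; rewrite rmorphM rmorphXn /= theta_alt_compNX.
  by rewrite [E2 \Po _](euler_compNX_even N 1).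
have H1 : eqm N (2 * G * F * bracket G F) (E2 ^+ 2 * bracket (theta N) (theta_alt N)).
  by rewrite -bracket_sqr -bracket_mul; apply/eqm_sym/eqm_bracket.
have H2 : eqm N (bracket (theta N) (theta_alt N)) (- ('X * (2 * E4 ^+ 3) ^+ 2)).
  apply: eqm_trans (@bracket_theta N) _.
  by apply/eqmN/eqmM => //; apply/eqmX/jacobi_cube.
have H3 : eqm N (F * G * E4) (E2 ^+ 3) := @euler_mul_compNX N.
(* This multiplier produces E2^3, to be traded for F G E4, and hence 2 F G [G, F], the bracket of
   the squares. *)
apply: (@eqm_mulI _ N (2 * E2 ^+ 2)).
  by rewrite -!horner_coef0 !hornerE horner_coef0 euler_coef0.
have -> : 2 * E2 ^+ 2 * (E2 * bracket G F) = 2 * bracket G F * E2 ^+ 3 by ring.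
apply: eqm_trans (eqmM (eqm_refl _) (eqm_sym H3)) _.
have -> : 2 * bracket G F * (F * G * E4) = 2 * G * F * bracket G F * E4 by ring.
apply: eqm_trans (eqmM (eqm_trans H1 (eqmM (eqm_refl _) H2)) (eqm_refl _)) _.
by apply: eqm_of_eq; ring.
Qed.

(** * Sums of two squares modulo p and divisibility of the bracket *)

(** Since (p - 1)/2 is odd, Fermat's x^p = x and x^2 = -y^2 give xy = -xy, hence xy = 0 as p is
    odd. *)
Lemma sum_sqr_Fp (p : nat) (x y : 'F_p) : prime p -> (p %% 4 = 3)%N ->
  x ^+ 2 + y ^+ 2 = 0 -> x = 0.
Proof.
move=> p_pr p3 xy0.
have Fermat (z : 'F_p) : z ^+ (2 * (p %/ 4).*2.+1).+1 = z.
  have <- : p = (2 * (p %/ 4).*2.+1).+1 by lia.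
  by rewrite -{2}(expf_card z) card_Fp.
have Ex : x ^+ 2 = - y ^+ 2 by apply/eqP; rewrite -subr_eq0 opprK xy0.
have xy : x * y = - (x * y).
  rewrite -{1}(Fermat x) exprS exprM Ex exprNn -signr_odd /= odd_double -exprM.
  by rewrite -[y in RHS](Fermat y) exprS expr1; ring.
have : x * y + x * y == 0 by rewrite {1}xy addNr.
rewrite -mulr2n -mulr_natl mulf_eq0 -(dvdn_pcharf (pchar_Fp p_pr)) gtnNdvd //=; last first.
  by rewrite ltn_neqAle prime_gt1 // andbT; apply/eqP => p2; move: p3; rewrite -p2.
rewrite mulf_eq0 => /orP[/eqP // | /eqP y0].
by apply/eqP; rewrite -sqrf_eq0 Ex y0 expr0n oppr0.
Qed.

Lemma dvdz_sum_sqr (p : nat) (x y : int) : prime p -> (p %% 4 = 3)%N ->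
  (p %| x ^+ 2 + y ^+ 2)%Z -> (p %| x)%Z.
Proof.
move=> p_pr p3; rewrite !(dvdz_pcharf (pchar_Fp p_pr)) rmorphD !rmorphXn /= => /eqP xy0.
by apply/eqP; apply: sum_sqr_Fp xy0.
Qed.

Lemma bracket_dvd p L i : prime p -> (p %% 4 = 3)%N -> (3 < p)%N -> (i <= L)%N ->
  (p %| 24 * i + 2)%N ->
  (p %| (bracket (euler L 1 \Po (- 'X)) (euler L 1))`_i)%Z.
Proof.
move=> p_pr p3 p_gt3 le_iL p_dvd; set F := euler L 1; set G := F \Po _.
have XDE (q : {poly int}) j : ('X * q^`())`_j = j%:Z * q`_j.
  by rewrite coefXM; case: j => [|j] /=; rewrite ?mul0r // coef_deriv -mulr_natl natz.
have -> : bracket G F = G * ('X * F^`()) - ('X * G^`()) * F by rewrite /bracket; ring.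
rewrite coefB !coefM -sumrB; apply: (big_ind (fun z => (p %| z)%Z)); first exact: dvdz0.
  by move=> x y; apply: rpredD.
move=> j _; rewrite !XDE /G coef_comp_polyNX.
have -> : (-1) ^+ j * F`_j * ((i - j)%N%:Z * F`_(i - j)) - j%:Z * ((-1) ^+ j * F`_j) * F`_(i - j)
  = (-1) ^+ j * F`_j * F`_(i - j) * ((i - j)%N%:Z - j%:Z) by ring.
have le_ji : (j <= i)%N by rewrite -ltnS.
have [->|/pentagonal_support Fj] := eqVneq F`_j 0; first by rewrite mulr0 !mul0r dvdz0.
have [->|/pentagonal_support Fij] := eqVneq F`_(i - j) 0; first by rewrite mulr0 !mul0r dvdz0.
have [x Ex] := Fj (leq_trans le_ji le_iL).
have [y Ey] := Fij (leq_trans (leq_subr _ _) le_iL).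
have p_xy : (p %| x ^+ 2 + y ^+ 2)%Z.
  rewrite -Ex -Ey (_ : _ + _ = (24 * i + 2)%N%:Z) //; lia.
have p_x := dvdz_sum_sqr p_pr p3 p_xy.
have p_y : (p %| y)%Z by apply: (@dvdz_sum_sqr p y x) => //; rewrite addrC.
(* The bracket contributes the factor (i - j) - j; 24 times it is y^2 - x^2, and p > 3 is prime to
   24. *)
apply/dvdz_mull; have : (p %| 24%:Z * ((i - j)%N%:Z - j%:Z))%Z.
  rewrite (_ : _ * _ = y ^+ 2 - x ^+ 2); last by rewrite -Ex -Ey; ring.
  by apply: rpredB; rewrite expr2; apply: dvdz_mull.
rewrite Gauss_dvdzr // coprimezE !absz_nat prime_coprime // (_ : 24 = 2 ^ 3 * 3)%N //.
rewrite Euclid_dvdM // Euclid_dvdX // !dvdn_prime2 // andbT negb_or.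
by apply/andP; split; lia.
Qed.

(** * Generalized cubic partitions and the congruences *)

Lemma size_inv_coefs P n : size (inv_coefs P n) = n.+1.
Proof. by elim: n => //= n IHn; rewrite size_rcons IHn. Qed.

Lemma inv_coefs_mul (P : {poly int}) n : P`_0 = 1 -> eqm n (P * Poly (inv_coefs P n)) 1.
Proof.
move=> P0; elim: n => [|n IHn] i.
  by rewrite leqn0 => /eqP->; rewrite coef0M P0 coef_Poly coef1.
have coefE k : (k <= n)%N -> (Poly (inv_coefs P n.+1))`_k = (Poly (inv_coefs P n))`_k.
  by move=> le_kn; rewrite !coef_Poly /= nth_rcons size_inv_coefs ltnS le_kn.
rewrite leq_eqVlt => /orP[/eqP->|lt_in]; last first.
  rewrite -(IHn i) // !coefM; apply: eq_bigr => j _; rewrite coefE //.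
  by rewrite (leq_trans (leq_subr _ _)).
rewrite coefM coef1 big_ord_recl subn0 P0 mul1r coef_Poly [inv_coefs P n.+1]/=.
rewrite nth_rcons size_inv_coefs ltnn eqxx big_add1 big_mkord /= addrC.
apply/eqP; rewrite subr_eq0; apply/eqP/eq_bigr => j _.
by rewrite coef_Poly /= nth_rcons size_inv_coefs ifT // /bump /=; lia.
Qed.

Lemma f1f2powE c n : f1f2pow c n = euler n 1 * euler n 2 ^+ (c - 1).
Proof.
rewrite /f1f2pow big_add1 big_mkord big_split /= -prodrXl.
by congr (_ * _); apply: eq_bigr => k _; rewrite mul1n.
Qed.

Lemma euler_frobenius p L : prime p ->
  map_poly (intr : int -> 'F_p) (euler L 2 ^+ p) = map_poly intr (euler L (2 * p)).
Proof.
move=> p_pr; have pchar_p : p \in [pchar {poly 'F_p}] by rewrite pchar_poly pchar_Fp.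
rewrite rmorphXn /euler !rmorph_prod -prodrXl; apply: eq_bigr => j _ /=.
rewrite !rmorphB !rmorph1 /= !map_polyXn -!(pFrobenius_autE pchar_p) rmorphB rmorph1.
by rewrite /= (pFrobenius_autE pchar_p) -exprM mulnAC.
Qed.

Lemma eqm_comp_X2 (R : comNzRingType) n (p q : {poly R}) :
  eqm n p q -> eqm (2 * n).+1 (p \Po 'X^2) (q \Po 'X^2).
Proof. by move=> pq i le_i; rewrite !coef_comp_poly_Xn //; case: ifP => // _; apply: pq; lia. Qed.

Lemma gen_cubic_congruence p n : prime p -> (p %% 4 = 3)%N -> (6 < p)%N ->
  (p %| 24 * n + 13)%N -> (p %| a (p - 6) n)%Z.
Proof.
(* Index n of f_2^7/f_1 corresponds to index 2n + 1 of the bracket, whence the precision [L]. *)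
move=> p_pr p3 p_gt6 p_n; set L := (2 * n).+1.
set F := euler L 1; set E2 := euler L 2; set E4 := euler L 4.
(* Up to degree n, [A] is 1/(f_1 f_2^(p-7)) and [b] is f_2^7/f_1. *)
pose A : {poly int} := Poly (inv_coefs (f1f2pow (p - 6) n) n); pose b := A * E2 ^+ p.
have st k : (0 < k)%N -> eqm n (euler n k) (euler L k).
  by move=> k0; apply: euler_stable; nia.
have FA : eqm n (F * E2 ^+ (p - 7) * A) 1.
  have P0 : (f1f2pow (p - 6) n)`_0 = 1.
    by rewrite f1f2powE -horner_coef0 hornerM horner_exp !horner_coef0 !euler_coef0 // expr1n mul1r.
  apply: (eqm_trans _ (inv_coefs_mul P0)); rewrite -/A f1f2powE.
  rewrite (_ : p - 6 - 1 = p - 7)%N; last by lia.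
  exact: eqmM (eqm_sym (eqmM (st 1 isT) (eqmX _ (st 2 isT)))) (eqm_refl A).
have bF : eqm n (b * F) (E2 ^+ 7).
  have -> : b * F = F * E2 ^+ (p - 7) * A * E2 ^+ 7.
    by rewrite /b -{1}(subnK (_ : 7 <= p)%N) // exprD; ring.
  by apply: eqm_trans (eqmM FA (eqm_refl _)) _; rewrite mul1r.
have b2 : eqm L ((b \Po 'X^2) * E2) (E4 ^+ 7).
  have := eqm_comp_X2 bF; rewrite rmorphM rmorphXn /=.
  by rewrite [F \Po _]euler_comp_Xn [E2 \Po _]euler_comp_Xn.
have brE : eqm L (bracket (F \Po (- 'X)) F) (- (2 * 'X * (b \Po 'X^2))).
  apply: (@eqm_mulI _ L E2); first by rewrite euler_coef0.
  apply: eqm_trans (@bracket_euler L) _.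
  have -> : E2 * - (2 * 'X * (b \Po 'X^2)) = - (2 * 'X * ((b \Po 'X^2) * E2)) by ring.
  by apply/eqmN/eqmM => //; apply: eqm_sym.
(* At index 2m + 1 the condition of [bracket_dvd] concerns 24(2m + 1) + 2 = 2(24m + 13). *)
have b_dvd m : (m <= n)%N -> (p %| 24 * m + 13)%N -> (p %| b`_m)%Z.
  move=> le_mn p_m; have le_L : ((2 * m).+1 <= L)%N by rewrite /L; lia.
  have := @bracket_dvd p L (2 * m).+1 p_pr p3 _ le_L.
  rewrite (brE _ le_L) coefN -mulrA mulr_natl coefMn coefXM -mulr_natl /=.
  rewrite coef_comp_poly_Xn // dvdn_mulr // mulKn // rpredN Gauss_dvdzr; last first.
    by rewrite coprimezE !absz_nat prime_coprime // dvdn_prime2 //; lia.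
  by apply; [lia | rewrite (_ : _ + 2 = 2 * (24 * m + 13))%N ?dvdn_mull //; lia].
(* Modulo p, [b] is [A] times f_(2p), a series in q^(2p) with constant term 1. So b_m involves A
   only at indices congruent to m mod p, and strong induction on m applies. *)
have A_dvd m : (m <= n)%N -> (p %| 24 * m + 13)%N -> (p %| A`_m)%Z.
  elim/ltn_ind: m => m IHm le_mn p_m; have := b_dvd m le_mn p_m.
  rewrite !(dvdz_pcharf (pchar_Fp p_pr)).
  rewrite -!(coef_map (intr : int -> 'F_p)) {1}/b rmorphM /= euler_frobenius // mulrC.
  rewrite coefM big_ord_recl subn0 !coef_map euler_coef0 ?muln_gt0 ?prime_gt0 //=.
  rewrite mul1r big1 ?addr0 // => j _.
  have -> : euler L (2 * p) = euler L 1 \Po 'X^(2 * p) by rewrite euler_comp_Xn muln1.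
  rewrite !coef_map coef_comp_poly_Xn ?muln_gt0 ?prime_gt0 //.
  case: ifP => [p_j|_]; last by rewrite mul0r.
  have p_j' : (p %| bump 0 j)%N by apply: dvdn_trans p_j; rewrite dvdn_mull.
  have lt_j := ltn_ord j.
  apply/eqP; rewrite mulf_eq0 -!(dvdz_pcharf (pchar_Fp p_pr)); apply/orP; right.
  apply: IHm; rewrite /bump /= in p_j' *; [lia | lia |].
  rewrite -(dvdn_addl _ (dvdn_mull 24 p_j')) (_ : _ + _ = 24 * m + 13)%N //; lia.
by have := A_dvd n (leqnn n) p_n; rewrite /A coef_Poly.
Qed.

Theorem theorem1p1 : forall n : nat,
  (43 %| a 37 (43 * n + 12))%Z /\
  (47 %| a 41 (47 * n + 21))%Z /\
  (59 %| a 53 (59 * n + 56))%Z /\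
  (67 %| a 61 (67 * n + 19))%Z /\
  (71 %| a 65 (71 * n + 32))%Z /\
  (79 %| a 73 (79 * n + 62))%Z /\
  (83 %| a 77 (83 * n + 79))%Z.
Proof.
(* Each residue r solves 24r + 13 = 0 mod p, with quotient k; then p divides 24(pn + r) + 13. *)
have cong p r k n : prime p -> (p %% 4 = 3)%N -> (6 < p)%N -> (24 * r + 13 = p * k)%N ->
    (p %| a (p - 6) (p * n + r))%Z.
  move=> p_pr p3 p6 Er; apply: gen_cubic_congruence => //.
  by rewrite (_ : _ + 13 = p * (24 * n + k))%N ?dvdn_mulr //; lia.
move=> n; split; [exact: (cong 43 12 7) | split; [exact: (cong 47 21 11) |]].
split; [exact: (cong 59 56 23) | split; [exact: (cong 67 19 7) |]].
split; [exact: (cong 71 32 11) | split; [exact: (cong 79 62 19) |]].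
exact: (cong 83 79 23).
Qed.
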